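(* Let $f,g:A\vdash B$ be arrow terms of $\mathbf{L}_{\top,\bot}$ such that $A$ is in disjunctive normal form and $B$ is in conjunctive normal form. If $Gf=Gg$, then $f=g$ in $\mathbf{L}_{\top,\bot}$.
   Context: Formulae: $\mathcal{L}_{\top,\bot}$ is the set of formulae built from infinitely many propositional letters and the propositional constants $\top,\bot$ with the binary connectives $\wedge$ and $\vee$; $\xi$ stands for either $\wedge$ or $\vee$. Formulae in disjunctive normal form are defined inductively: every formula in which $\vee$ does not occur is in disjunctive normal form, and if $A$ and $B$ are both in disjunctive normal form, then so is $A\vee B$. Dually, every formula in which $\wedge$ does not occur is in conjunctive normal form, and if $A$ and $B$ are both in conjunctive normal form, then so is $A\wedge B$. The category $\mathbf{L}_{\top,\bot}$: its objects are the formulae of $\mathcal{L}_{\top,\bot}$. Arrow terms are typed expressions, where $f:A\vdash B$ means that $f$ has source $A$ and target $B$. For all formulae $A,A_1,A_2$ and $i\in\{1,2\}$ the primitive arrow terms are $\mathbf{1}_A:A\vdash A$, $\hat w_A:A\vdash A\wedge A$, $\check w_A:A\vee A\vdash A$, $\hat k^i_{A_1,A_2}:A_1\wedge A_2\vdash A_i$, $\check k^i_{A_1,A_2}:A_i\vdash A_1\vee A_2$, $\hat\kappa_A:A\vdash\top$, $\check\kappa_A:\bot\vdash A$. If $f:A\vdash B$ and $g:B\vdash C$ are arrow terms, so is $g\circ f:A\vdash C$; if $f_j:A_j\vdash B_j$ ($j=1,2$) are arrow terms, so is $f_1\mathbin{\xi}f_2:A_1\mathbin{\xi}A_2\vdash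 B_1\mathbin{\xi}B_2$. The equations of $\mathbf{L}_{\top,\bot}$ are the smallest set of equations between arrow terms of the same type that contains all instances of $f=f$ and of the following, and is closed under symmetry, transitivity and congruence with respect to $\circ$, $\wedge$ and $\vee$ on arrow terms: categorial: $f\circ\mathbf{1}_A=\mathbf{1}_B\circ f=f$ for $f:A\vdash B$, $h\circ(g\circ f)=(h\circ g)\circ f$; bifunctorial: $\mathbf{1}_A\mathbin{\xi}\mathbf{1}_B=\mathbf{1}_{A\xi B}$, $(g_1\circ f_1)\mathbin{\xi}(g_2\circ f_2)=(g_1\mathbin{\xi}g_2)\circ(f_1\mathbin{\xi}f_2)$; naturality (for $f:A\vdash B$, $f_j:A_j\vdash B_j$): $(f\wedge f)\circ\hat w_A=\hat w_B\circ f$, $f\circ\check w_A=\check w_B\circ(f\vee f)$, $f_i\circ\hat k^i_{A_1,A_2}=\hat k^i_{B_1,B_2}\circ(f_1\wedge f_2)$, $(f_1\vee f_2)\circ\check k^i_{A_1,A_2}=\check k^i_{B_1,B_2}\circ f_i$; triangular: $\hat k^i_{A,A}\circ\hat w_A=\mathbf{1}_A$, $\check w_A\circ\check k^i_{A,A}=\mathbf{1}_A$, $(\hat k^1_{A,B}\wedge\hat k^2_{A,B})\circ\hat w_{A\wedge B}=\mathbf{1}_{A\wedge B}$, $\check w_{A\vee B}\circ(\check k^1_{A,B}\vee\check k^2_{A,B})=\mathbf{1}_{A\vee B}$; terminal/initial: $\hat\kappa_A=f$ for every $f:A\vdash\top$, $\check\kappa_A=g$ for every $g:\bot\vdash A$;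 $\hat k^1_{\bot,\bot}=\hat k^2_{\bot,\bot}$ and $\check k^1_{\top,\top}=\check k^2_{\top,\top}$. Arrows of $\mathbf{L}_{\top,\bot}$ are equivalence classes of arrow terms modulo these equations. The category $\mathit{Rel}$ and the functor $G$: objects of $\mathit{Rel}$ are the formulae of $\mathcal{L}_{\top,\bot}$; an arrow $R:A\vdash B$ is a binary relation from the set of occurrences of propositional letters in $A$ to the set of occurrences of propositional letters in $B$ (constants $\top,\bot$ are not letters); composition is $R_2\circ R_1=\{(x,y)\mid\exists z\,(xR_1z\text{ and }zR_2y)\}$, identities are identity relations. Let $|A|$ be the number of letter occurrences in $A$ and $x_j(A)$ the $j$-th one from the left. $R_1\mathbin{\xi}R_2$ is the disjoint union of $R_1$ and $R_2$ placed side by side: it consists of the pairs $(x_j(A_1\xi A_2),x_k(B_1\xi B_2))$ with $(x_j(A_1),x_k(B_1))\in R_1$ and $(x_{j+|A_1|}(A_1\xi A_2),x_{k+|B_1|}(B_1\xi B_2))$ with $(x_j(A_2),x_k(B_2))\in R_2$. The functor $G:\mathbf{L}_{\top,\bot}\to\mathit{Rel}$ is the identity on objects, preserves identities, $\circ$, $\wedge$, $\vee$, and satisfies: $(x_j(A),x_k(A\wedge A))\in G\hat w_A$ iff $(x_k(A\vee A),x_j(A))\in G\check w_A$ iff $j\equiv k\pmod{|A|}$; $(x_j(A_1\wedge A_2),x_k(A_1))\in G\hat k^1_{A_1,A_2}$ iff $(x_k(A_1),x_j(A_1\vee A_2))\in G\check k^1_{A_1,A_2}$ iff $j=k$; $(x_j(A_1\wedge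 A_2),x_k(A_2))\in G\hat k^2_{A_1,A_2}$ iff $(x_k(A_2),x_j(A_1\vee A_2))\in G\check k^2_{A_1,A_2}$ iff $j=k+|A_1|$; and $G\hat\kappa_A=G\check\kappa_A=\emptyset$. *)

(* Defs.v *)
From mathcomp Require Import all_boot.

Set Implicit Arguments.
Unset Strict Implicit.
Unset Printing Implicit Defensive.

Declare Scope lattice_scope.
Delimit Scope lattice_scope with L.

Inductive formula (P : Type) : Type :=
| Letter of P
| Top
| Bot
| And of formula P & formula P
| Or of formula P & formula P.

Arguments Top {P}.
Arguments Bot {P}.
Notation "A ∧ B" := (And A B) (at level 40, left associativity) : lattice_scope.
Notation "A ∨ B" := (Or A B) (at level 50, left associativity) : lattice_scope.
Notation "⊤" := Top : lattice_scope.
Notation "⊥" := Bot : lattice_scope.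
Bind Scope lattice_scope with formula.
Local Open Scope lattice_scope.

Fixpoint or_free P (A : formula P) : bool :=
  match A with
  | Letter _ | Top | Bot => true
  | And A1 A2 => or_free A1 && or_free A2
  | Or _ _ => false
  end.

Fixpoint and_free P (A : formula P) : bool :=
  match A with
  | Letter _ | Top | Bot => true
  | And _ _ => false
  | Or A1 A2 => and_free A1 && and_free A2
  end.

Inductive dnf P : formula P -> Prop :=
| dnf_or_free A : or_free A -> dnf A
| dnf_or A B : dnf A -> dnf B -> dnf (A ∨ B).

Inductive cnf P : formula P -> Prop :=
| cnf_and_free A : and_free A -> cnf A
| cnf_and A B : cnf A -> cnf B -> cnf (A ∧ B).

(* In the names below, the suffix [a] ("and") stands for a hat, and [o] ("or")
   for a check: [wa] is $\hat w$, [ko1] is $\check k^1$, [kappaa] is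
   $\hat\kappa$, and so on. *)
Inductive arrow_term P : formula P -> formula P -> Type :=
| idt A : arrow_term A A
| wa A : arrow_term A (A ∧ A)
| wo A : arrow_term (A ∨ A) A
| ka1 A1 A2 : arrow_term (A1 ∧ A2) A1
| ka2 A1 A2 : arrow_term (A1 ∧ A2) A2
| ko1 A1 A2 : arrow_term A1 (A1 ∨ A2)
| ko2 A1 A2 : arrow_term A2 (A1 ∨ A2)
| kappaa A : arrow_term A ⊤
| kappao A : arrow_term ⊥ A
| acomp A B C (g : arrow_term B C) (f : arrow_term A B) : arrow_term A C
| para A1 A2 B1 B2 (f1 : arrow_term A1 B1) (f2 : arrow_term A2 B2) :
    arrow_term (A1 ∧ A2) (B1 ∧ B2)
| paro A1 A2 B1 B2 (f1 : arrow_term A1 B1) (f2 : arrow_term A2 B2) :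
    arrow_term (A1 ∨ A2) (B1 ∨ B2).

Declare Scope arrow_scope.
Delimit Scope arrow_scope with A.
Bind Scope arrow_scope with arrow_term.
Notation "A ⊢ B" := (arrow_term A%L B%L) (at level 70, no associativity) : type_scope.
Notation "g ∘ f" := (acomp g f) (at level 60, right associativity) : arrow_scope.
Notation "f ∧ g" := (para f g) (at level 40, left associativity) : arrow_scope.
Notation "f ∨ g" := (paro f g) (at level 50, left associativity) : arrow_scope.

Reserved Notation "f ≡ g" (at level 70, no associativity).

Inductive aeq P : forall A B : formula P, A ⊢ B -> A ⊢ B -> Prop :=
| aeq_refl A B (f : A ⊢ B) : f ≡ f
| aeq_sym A B (f g : A ⊢ B) : f ≡ g -> g ≡ f
| aeq_trans A B (f g h : A ⊢ B) : f ≡ g -> g ≡ h -> f ≡ h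
| aeq_comp A B C (g g' : B ⊢ C) (f f' : A ⊢ B) :
    g ≡ g' -> f ≡ f' -> (g ∘ f) ≡ (g' ∘ f')
| aeq_para A1 A2 B1 B2 (f1 f1' : A1 ⊢ B1) (f2 f2' : A2 ⊢ B2) :
    f1 ≡ f1' -> f2 ≡ f2' -> (f1 ∧ f2) ≡ (f1' ∧ f2')
| aeq_paro A1 A2 B1 B2 (f1 f1' : A1 ⊢ B1) (f2 f2' : A2 ⊢ B2) :
    f1 ≡ f1' -> f2 ≡ f2' -> (f1 ∨ f2) ≡ (f1' ∨ f2')
| aeq_idr A B (f : A ⊢ B) : (f ∘ idt A) ≡ f
| aeq_idl A B (f : A ⊢ B) : (idt B ∘ f) ≡ f
| aeq_assoc A B C D (f : A ⊢ B) (g : B ⊢ C) (h : C ⊢ D) :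
    (h ∘ (g ∘ f)) ≡ ((h ∘ g) ∘ f)
| aeq_para_id A B : (idt A ∧ idt B) ≡ idt (A ∧ B)
| aeq_paro_id A B : (idt A ∨ idt B) ≡ idt (A ∨ B)
| aeq_para_comp A1 A2 B1 B2 C1 C2
    (f1 : A1 ⊢ B1) (f2 : A2 ⊢ B2) (g1 : B1 ⊢ C1) (g2 : B2 ⊢ C2) :
    ((g1 ∘ f1) ∧ (g2 ∘ f2)) ≡ ((g1 ∧ g2) ∘ (f1 ∧ f2))
| aeq_paro_comp A1 A2 B1 B2 C1 C2
    (f1 : A1 ⊢ B1) (f2 : A2 ⊢ B2) (g1 : B1 ⊢ C1) (g2 : B2 ⊢ C2) :
    ((g1 ∘ f1) ∨ (g2 ∘ f2)) ≡ ((g1 ∨ g2) ∘ (f1 ∨ f2))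
| aeq_wa_nat A B (f : A ⊢ B) : ((f ∧ f) ∘ wa A) ≡ (wa B ∘ f)
| aeq_wo_nat A B (f : A ⊢ B) : (f ∘ wo A) ≡ (wo B ∘ (f ∨ f))
| aeq_ka1_nat A1 A2 B1 B2 (f1 : A1 ⊢ B1) (f2 : A2 ⊢ B2) :
    (f1 ∘ ka1 A1 A2) ≡ (ka1 B1 B2 ∘ (f1 ∧ f2))
| aeq_ka2_nat A1 A2 B1 B2 (f1 : A1 ⊢ B1) (f2 : A2 ⊢ B2) :
    (f2 ∘ ka2 A1 A2) ≡ (ka2 B1 B2 ∘ (f1 ∧ f2))
| aeq_ko1_nat A1 A2 B1 B2 (f1 : A1 ⊢ B1) (f2 : A2 ⊢ B2) :
    ((f1 ∨ f2) ∘ ko1 A1 A2) ≡ (ko1 B1 B2 ∘ f1)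
| aeq_ko2_nat A1 A2 B1 B2 (f1 : A1 ⊢ B1) (f2 : A2 ⊢ B2) :
    ((f1 ∨ f2) ∘ ko2 A1 A2) ≡ (ko2 B1 B2 ∘ f2)
| aeq_ka1_wa A : (ka1 A A ∘ wa A) ≡ idt A
| aeq_ka2_wa A : (ka2 A A ∘ wa A) ≡ idt A
| aeq_wo_ko1 A : (wo A ∘ ko1 A A) ≡ idt A
| aeq_wo_ko2 A : (wo A ∘ ko2 A A) ≡ idt A
| aeq_ka_wa A B : ((ka1 A B ∧ ka2 A B) ∘ wa (A ∧ B)) ≡ idt (A ∧ B)
| aeq_wo_ko A B : (wo (A ∨ B) ∘ (ko1 A B ∨ ko2 A B)) ≡ idt (A ∨ B)
| aeq_terminal A (f : A ⊢ ⊤) : kappaa A ≡ f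
| aeq_initial A (g : ⊥ ⊢ A) : kappao A ≡ g
| aeq_ka_bot : ka1 ⊥ ⊥ ≡ ka2 ⊥ ⊥
| aeq_ko_top : ko1 ⊤ ⊤ ≡ ko2 ⊤ ⊤
where "f ≡ g" := (aeq f%A g%A) : type_scope.

Fixpoint nletters P (A : formula P) : nat :=
  match A with
  | Letter _ => 1
  | Top | Bot => 0
  | And A1 A2 | Or A1 A2 => nletters A1 + nletters A2
  end.

(* The occurrence x_j(A) is represented by its position from the left, counted
   from 0; the occurrences of A1 (resp. A2) in A1 ∧ A2 and A1 ∨ A2 are then
   the images of [lshift] (resp. [rshift]). *)
Notation occ A := 'I_(nletters A).

Definition Rel P (A B : formula P) := {set occ A * occ B}.

Section RelOperations.
Variable P : Type.
Implicit Types A B C : formula P.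

Definition rel_id A : Rel A A := [set p | p.1 == p.2].

Definition rel_comp A B C (R2 : Rel B C) (R1 : Rel A B) : Rel A C :=
  [set p | [exists z, ((p.1, z) \in R1) && ((z, p.2) \in R2)]].

(* This serves both connectives, since [nletters (A1 ∧ A2)] and
   [nletters (A1 ∨ A2)] are both convertible to the sum. *)
Definition rel_par A1 A2 B1 B2 (R1 : Rel A1 B1) (R2 : Rel A2 B2) :
    {set 'I_(nletters A1 + nletters A2) * 'I_(nletters B1 + nletters B2)} :=
  [set (lshift _ p.1, lshift _ p.2) | p in R1]
    :|: [set (rshift _ p.1, rshift _ p.2) | p in R2].

End RelOperations.

Fixpoint G P (A B : formula P) (f : A ⊢ B) : Rel A B :=
  match f in arrow_term A B return Rel A B with
  | idt A => rel_id A
  | wa A => [set p : occ A * occ (A ∧ A) | p.1 == p.2 %[mod nletters A]]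
  | wo A => [set p : occ (A ∨ A) * occ A | p.1 == p.2 %[mod nletters A]]
  | ka1 A1 A2 => [set p : occ (A1 ∧ A2) * occ A1 | p.1 == p.2 :> nat]
  | ka2 A1 A2 =>
      [set p : occ (A1 ∧ A2) * occ A2 | p.1 == p.2 + nletters A1 :> nat]
  | ko1 A1 A2 => [set p : occ A1 * occ (A1 ∨ A2) | p.2 == p.1 :> nat]
  | ko2 A1 A2 =>
      [set p : occ A2 * occ (A1 ∨ A2) | p.2 == p.1 + nletters A1 :> nat]
  | kappaa A => set0
  | kappao A => set0
  | acomp _ _ _ g f => rel_comp (G g) (G f)
  | para _ _ _ _ f1 f2 => rel_par (G f1) (G f2)
  | paro _ _ _ _ f1 f2 => rel_par (G f1) (G f2)
  end.

(* Main.v *)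
Require Import Defs.
From mathcomp Require Import all_boot.
From Stdlib Require Import Setoid Morphisms Eqdep_dec.

(** Arrows out of A1 ∨ A2 are determined by their composites with the two
    injections, and arrows into B1 ∧ B2 by their composites with the two
    projections ([copair_ext], [pair_ext]), so it suffices to treat A without ∨
    and B without ∧ ([coherence_free]). Such an A is a conjunction, and such a
    B a disjunction, of letters and constants.

    Every f : A ⊢ B is then of one of two kinds ([normal_form]): either it is
    null, that is, it factors through ⊥ or through ⊤, or it is a projection of
    A onto one letter occurrence followed by the injection of this letter as an
    occurrence of B. This plays the part of cut elimination, but is obtained by
    a logical predicate: [resolved] describes, by recursion on C, the arrows
    A ⊢ C whose every disjunctive choice has been made and whose every
    letter component is a projection of A or comes from ⊥. Every arrow term
    preserves it under postcomposition ([resolved_comp]), and the identity of A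
    satisfies it, since A has no ∨ ([resolved_id]).

    The equation between the two projections of ⊥ ∧ ⊥ makes any two arrows
    into ⊥ equal, and dually for arrows from ⊤; hence any two null arrows of
    the same type are equal ([null_uniq]). The relation of a null arrow is
    empty, whereas that of an arrow of the other kind is the single pair of
    occurrences that it links, and this pair determines the arrow
    ([through_letter_uniq]). As G is invariant under the equations
    ([rel_aeq], [mem_G]), it separates all the cases. *)

Set Implicit Arguments.
Unset Strict Implicit.
Unset Printing Implicit Defensive.

Local Open Scope lattice_scope.

(** * Rewriting with the equations *)

#[local] Instance aeq_Equivalence P (A B : formula P) :
  Equivalence (@aeq P A B).
Proof.
split; [exact: aeq_refl | exact: aeq_sym | exact: aeq_trans].
Qed.

#[local] Hint Resolve aeq_refl : core.

#[local] Instance acomp_Proper P (A B C : formula P) :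
  Proper (@aeq P B C ==> @aeq P A B ==> @aeq P A C) (@acomp P A B C).
Proof. by move=> g g' gg' f f' ff'; apply: aeq_comp. Qed.

#[local] Instance para_Proper P (A1 A2 B1 B2 : formula P) :
  Proper (@aeq P A1 B1 ==> @aeq P A2 B2 ==> @aeq P (A1 ∧ A2) (B1 ∧ B2))
         (@para P A1 A2 B1 B2).
Proof. by move=> f f' ff' g g' gg'; apply: aeq_para. Qed.

#[local] Instance paro_Proper P (A1 A2 B1 B2 : formula P) :
  Proper (@aeq P A1 B1 ==> @aeq P A2 B2 ==> @aeq P (A1 ∨ A2) (B1 ∨ B2))
         (@paro P A1 A2 B1 B2).
Proof. by move=> f f' ff' g g' gg'; apply: aeq_paro. Qed.

(** * Invariance of G under the equations *)

(** Letter occurrences as paths in the formula instead of positions: both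
    connectives become disjoint sums on the nose, so that the invariance of G
    under each equation is a mere case analysis. *)
Fixpoint leaf P (A : formula P) : Type :=
  match A with
  | Letter _ => unit
  | Top | Bot => Empty_set
  | And A1 A2 | Or A1 A2 => (leaf A1 + leaf A2)%type
  end.

Definition rel_sum (X1 X2 Y1 Y2 : Type) (R1 : X1 -> Y1 -> Prop)
    (R2 : X2 -> Y2 -> Prop) (x : X1 + X2) (y : Y1 + Y2) : Prop :=
  match x, y with
  | inl x, inl y => R1 x y
  | inr x, inr y => R2 x y
  | _, _ => False
  end.

(** The functor G, transported along the bijection [pos] below. *)
Fixpoint rel P (A B : formula P) (f : A ⊢ B) : leaf A -> leaf B -> Prop :=
  match f in arrow_term A B return leaf A -> leaf B -> Prop with
  | idt A => fun x y => x = y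
  | wa A => fun x y => match y with inl y | inr y => x = y end
  | wo A => fun x y => match x with inl x | inr x => x = y end
  | ka1 A1 A2 => fun x y => x = inl y
  | ka2 A1 A2 => fun x y => x = inr y
  | ko1 A1 A2 => fun x y => y = inl x
  | ko2 A1 A2 => fun x y => y = inr x
  | kappaa A => fun _ _ => False
  | kappao A => fun _ _ => False
  | acomp _ _ _ g f => fun x y => exists z, rel f x z /\ rel g z y
  | para _ _ _ _ f1 f2 => rel_sum (rel f1) (rel f2)
  | paro _ _ _ _ f1 f2 => rel_sum (rel f1) (rel f2)
  end.


Ltac split_leaves :=
  repeat (match goal with
  | x : (_ + _)%type |- _ => destruct x
  | x : Empty_set |- _ => destruct x
  | H : exists _, _ |- _ => destruct H
  | H : _ /\ _ |- _ => destruct H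
  | H : inl _ = inl _ |- _ => injection H as H
  | H : inr _ = inr _ |- _ => injection H as H
  | H : inr _ = inl _ |- _ => discriminate H
  | H : inl _ = inr _ |- _ => discriminate H
  | H : False |- _ => destruct H
  end; simpl in * ); subst.

Lemma rel_aeq P (A B : formula P) (f g : A ⊢ B) :
  f ≡ g -> forall x y, rel f x y <-> rel g x y.
Proof.
elim=> {A B f g}; rewrite /rel_sum /=.
- by [].
- by move=> A B f g _ IH x y; rewrite IH.
- by move=> A B f g h _ IH1 _ IH2 x y; rewrite IH1.
- move=> A B C g g' f f' _ IHg _ IHf x y.
  by split=> -[z [/IHf Hf /IHg Hg]]; exists z.
- by move=> A1 A2 B1 B2 f1 f1' f2 f2' _ IH1 _ IH2 [x|x] [y|y] /=;
    rewrite ?IH1 ?IH2.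
- by move=> A1 A2 B1 B2 f1 f1' f2 f2' _ IH1 _ IH2 [x|x] [y|y] /=;
    rewrite ?IH1 ?IH2.
(* In the remaining equations an intermediate occurrence, where one is needed,
   is either at hand or one of its images in a sum. *)
all: intros; split_leaves; split; intros; split_leaves;
  solve [eauto
        | eexists (inl _); simpl; eauto
        | eexists (inr _); simpl; eauto
        | eexists (inl (inl _)); simpl; eauto
        | eexists (inr (inr _)); simpl; eauto].
Qed.

Fixpoint pos P (A : formula P) : leaf A -> occ A :=
  match A return leaf A -> occ A with
  | Letter _ => fun _ => ord0
  | Top | Bot => fun x => match x with end
  | And A1 A2 | Or A1 A2 => fun x =>
      match x with
      | inl x => lshift (nletters A2) (pos x)
      | inr x => rshift (nletters A1) (pos x)
      end
  end.

Lemma pos_inj P (A : formula P) : injective (@pos P A).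
Proof.
elim: A => [p|||A1 IH1 A2 IH2|A1 IH1 A2 IH2] /=; try by case.
- by case; case.
- by move=> [x|x] [y|y] /eqP;
    rewrite ?eq_lshift ?eq_rshift ?eq_lrshift ?eq_rlshift // => /eqP;
    [move=> /IH1 -> | move=> /IH2 ->].
- by move=> [x|x] [y|y] /eqP;
    rewrite ?eq_lshift ?eq_rshift ?eq_lrshift ?eq_rlshift // => /eqP;
    [move=> /IH1 -> | move=> /IH2 ->].
Qed.

Lemma pos_surj P (A : formula P) (i : occ A) : exists x, i = pos x.
Proof.
elim: A i => [p|||A1 IH1 A2 IH2|A1 IH1 A2 IH2] /=; try by case.
- by move=> i; exists tt; rewrite (ord1 i).
- move=> i; case: (split_ordP i) => j ->.
    by case: (IH1 j) => x ->; exists (inl x).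
  by case: (IH2 j) => x ->; exists (inr x).
- move=> i; case: (split_ordP i) => j ->.
    by case: (IH1 j) => x ->; exists (inl x).
  by case: (IH2 j) => x ->; exists (inr x).
Qed.

Lemma pos_eq P (A : formula P) (x y : leaf A) :
  (pos x == pos y :> nat) <-> x = y.
Proof. by split=> [/eqP /val_inj /pos_inj | ->]. Qed.

Lemma mem_rel_par P (A1 A2 B1 B2 : formula P) (R1 : Rel A1 B1) (R2 : Rel A2 B2)
    (x : leaf A1 + leaf A2) (y : leaf B1 + leaf B2) :
  (@pos P (A1 ∧ A2) x, @pos P (B1 ∧ B2) y) \in rel_par R1 R2 <->
  rel_sum (fun x y => (pos x, pos y) \in R1)
          (fun x y => (pos x, pos y) \in R2) x y.
Proof.
rewrite in_setU; split.
- case/orP=> /imsetP[[i j] Rij /eqP]; rewrite xpair_eqE;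
    case: x y => x [y|y]; rewrite /= !eq_shift ?andbF // =>
    /andP[/eqP -> /eqP ->];
    exact: Rij.
- case: x y => x [y|y] //= Rxy; apply/orP; [left | right];
    by apply/imsetP; exists (pos x, pos y).
Qed.

(** The positional clauses of G, including the congruences modulo the number of
    letters for the diagonals, say the same as the clauses of [rel]. *)
Lemma mem_G P (A B : formula P) (f : A ⊢ B) (x : leaf A) (y : leaf B) :
  (pos x, pos y) \in G f <-> rel f x y.
Proof.
elim: f x y => {A B} /=.
- by move=> A x y; rewrite inE /=; apply: pos_eq.
- move=> A x [y|y]; rewrite inE /= ?modnDl !modn_small //; exact: pos_eq.
- move=> A [x|x] y; rewrite inE /= ?modnDl !modn_small //; exact: pos_eq.
- move=> A1 A2 [x|x] y; rewrite inE /=.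
    by rewrite pos_eq; split=> [-> | [->]].
  split=> // /eqP E; have := ltn_ord (pos y).
  by rewrite -E ltnNge leq_addr.
- move=> A1 A2 [x|x] y; rewrite inE /=.
    split=> // /eqP E; have := ltn_ord (pos x).
    by rewrite E ltnNge leq_addl.
  by rewrite addnC eqn_add2r pos_eq; split=> [-> | [->]].
- move=> A1 A2 x [y|y]; rewrite inE /=.
    by rewrite pos_eq; split=> [-> | [->]].
  split=> // /eqP E; have := ltn_ord (pos x).
  by rewrite -E ltnNge leq_addr.
- move=> A1 A2 x [y|y]; rewrite inE /=.
    split=> // /eqP E; have := ltn_ord (pos y).
    by rewrite E ltnNge leq_addl.
  by rewrite addnC eqn_add2r pos_eq; split=> [-> | [->]].
- by [].
- by [].
- move=> A B C g IHg f IHf x y; rewrite inE /=; split.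
    case/existsP=> i; have [z ->] := pos_surj i.
    by case/andP=> /IHf Hf /IHg Hg; exists z.
  case=> z [/IHf Hf /IHg Hg]; apply/existsP; exists (pos z).
  by rewrite Hf Hg.
- move=> A1 A2 B1 B2 f1 IH1 f2 IH2 x y.
  rewrite (mem_rel_par (G f1) (G f2) x y).
  by case: x y => x [y|y] /=.
- move=> A1 A2 B1 B2 f1 IH1 f2 IH2 x y.
  have E := mem_rel_par (G f1) (G f2) x y.
  by case: x y E => x [y|y] /= ->.
Qed.

Lemma G_rel P (A B : formula P) (f g : A ⊢ B) :
  G f = G g -> forall x y, rel f x y <-> rel g x y.
Proof. by move=> E x y; rewrite -!mem_G E. Qed.

(** * Null arrows *)

Section Lattice.
Variable P : Type.
Implicit Types A B C : formula P.

(** Both arrows are components of the arrow A ⊢ ⊥ ∧ ⊥ that pairs them, and the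
    two projections of ⊥ ∧ ⊥ are equal. *)
Lemma to_bot_uniq A (f g : A ⊢ ⊥) : f ≡ g.
Proof.
have H1 : (ka1 ⊥ ⊥ ∘ (f ∧ g) ∘ wa A)%A ≡ f.
  by rewrite aeq_assoc -aeq_ka1_nat -aeq_assoc aeq_ka1_wa aeq_idr.
have H2 : (ka2 ⊥ ⊥ ∘ (f ∧ g) ∘ wa A)%A ≡ g.
  by rewrite aeq_assoc -aeq_ka2_nat -aeq_assoc aeq_ka2_wa aeq_idr.
by apply: aeq_trans H2; apply: aeq_trans (aeq_sym H1) _; rewrite aeq_ka_bot.
Qed.

Lemma from_top_uniq A (f g : ⊤ ⊢ A) : f ≡ g.
Proof.
have H1 : (wo A ∘ (f ∨ g) ∘ ko1 ⊤ ⊤)%A ≡ f.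
  by rewrite aeq_ko1_nat aeq_assoc aeq_wo_ko1 aeq_idl.
have H2 : (wo A ∘ (f ∨ g) ∘ ko2 ⊤ ⊤)%A ≡ g.
  by rewrite aeq_ko2_nat aeq_assoc aeq_wo_ko2 aeq_idl.
by apply: aeq_trans H2; apply: aeq_trans (aeq_sym H1) _; rewrite aeq_ko_top.
Qed.

Definition null A B (f : A ⊢ B) : Prop :=
  (exists q : A ⊢ ⊥, f ≡ (kappao B ∘ q)) \/
  (exists j : ⊤ ⊢ B, f ≡ (j ∘ kappaa A)).

(** Both sides are the composite of q, the arrow ⊥ ⊢ ⊤ and j. *)
Lemma null_mixed A B (q : A ⊢ ⊥) (j : ⊤ ⊢ B) :
  (kappao B ∘ q) ≡ (j ∘ kappaa A).
Proof.
by rewrite (aeq_initial (j ∘ kappaa ⊥)) -aeq_assoc -(aeq_terminal (_ ∘ q)).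
Qed.

Lemma null_uniq A B (f g : A ⊢ B) : null f -> null g -> f ≡ g.
Proof.
case=> [[q ->]|[j ->]] [[q' ->]|[j' ->]].
- by rewrite (to_bot_uniq q q').
- exact: null_mixed.
- by rewrite null_mixed.
- by rewrite (from_top_uniq j j').
Qed.

Lemma rel_null A B (f : A ⊢ B) x y : null f -> ~ rel f x y.
Proof.
by case=> [[q /rel_aeq ->]|[j /rel_aeq ->]] /= [z [Hz1 Hz2]].
Qed.

(** * Universal properties of the connectives *)

Lemma copair_ext A1 A2 B (f g : A1 ∨ A2 ⊢ B) :
  (f ∘ ko1 A1 A2) ≡ (g ∘ ko1 A1 A2) -> (f ∘ ko2 A1 A2) ≡ (g ∘ ko2 A1 A2) ->
  f ≡ g.
Proof.
have E (h : A1 ∨ A2 ⊢ B) :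
    h ≡ (wo B ∘ ((h ∘ ko1 A1 A2) ∨ (h ∘ ko2 A1 A2)))%A.
  by rewrite aeq_paro_comp aeq_assoc -aeq_wo_nat -aeq_assoc aeq_wo_ko aeq_idr.
by move=> H1 H2; rewrite (E f) (E g) H1 H2.
Qed.

Lemma pair_ext A B1 B2 (f g : A ⊢ B1 ∧ B2) :
  (ka1 B1 B2 ∘ f) ≡ (ka1 B1 B2 ∘ g) -> (ka2 B1 B2 ∘ f) ≡ (ka2 B1 B2 ∘ g) ->
  f ≡ g.
Proof.
have E (h : A ⊢ B1 ∧ B2) :
    h ≡ (((ka1 B1 B2 ∘ h) ∧ (ka2 B1 B2 ∘ h)) ∘ wa A)%A.
  by rewrite aeq_para_comp -aeq_assoc aeq_wa_nat aeq_assoc aeq_ka_wa aeq_idl.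
by move=> H1 H2; rewrite (E f) (E g) H1 H2.
Qed.

(** * Projections to a letter and injections of a letter *)

(** The projection of A onto the letter occurrence x. It exists when x lies
    under no ∨; otherwise the value is [None]. *)
Fixpoint letter_proj A : leaf A -> option {p & A ⊢ Letter p} :=
  match A return leaf A -> option {p & A ⊢ Letter p} with
  | Letter p => fun _ => Some (existT _ p (idt (Letter p)))
  | And A1 A2 => fun x =>
      match x with
      | inl x => omap (fun q => existT _ (projT1 q) (projT2 q ∘ ka1 A1 A2)%A)
                      (letter_proj x)
      | inr x => omap (fun q => existT _ (projT1 q) (projT2 q ∘ ka2 A1 A2)%A)
                      (letter_proj x)
      end
  | _ => fun _ => None
  end.

(** Dually, the injection at the letter occurrence y, which exists when y lies
    under no ∧. *)
Fixpoint letter_inj B : leaf B -> option {p & Letter p ⊢ B} :=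
  match B return leaf B -> option {p & Letter p ⊢ B} with
  | Letter p => fun _ => Some (existT _ p (idt (Letter p)))
  | Or B1 B2 => fun y =>
      match y with
      | inl y => omap (fun j => existT _ (projT1 j) (ko1 B1 B2 ∘ projT2 j)%A)
                      (letter_inj y)
      | inr y => omap (fun j => existT _ (projT1 j) (ko2 B1 B2 ∘ projT2 j)%A)
                      (letter_inj y)
      end
  | _ => fun _ => None
  end.

Lemma rel_letter_proj A x u : @letter_proj A x = Some u ->
  forall z t, rel (projT2 u) z t <-> z = x.
Proof.
elim: A x u => [p|||A1 IH1 A2 IH2|//] /=; try by case.
- by case=> u [<-] /= [] [].
- move=> [x|x] u; [case E: (letter_proj x) (IH1 x) => [v|] //|
                   case E: (letter_proj x) (IH2 x) => [v|] //].
  all: move=> /(_ _ erefl) H [<-] z t /=; split.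
  + by case=> a [-> /H ->].
  + by move=> ->; exists x; split=> //; apply/H.
  + by case=> a [-> /H ->].
  + by move=> ->; exists x; split=> //; apply/H.
Qed.

Lemma rel_letter_inj B y u : @letter_inj B y = Some u ->
  forall t z, rel (projT2 u) t z <-> z = y.
Proof.
elim: B y u => [p|||//|B1 IH1 B2 IH2] /=; try by case.
- by case=> u [<-] /= [] [].
- move=> [y|y] u; [case E: (letter_inj y) (IH1 y) => [v|] //|
                   case E: (letter_inj y) (IH2 y) => [v|] //].
  all: move=> /(_ _ erefl) H [<-] t z /=; split.
  + by case=> a [/H -> ->].
  + by move=> ->; exists y; split=> //; apply/H.
  + by case=> a [/H -> ->].
  + by move=> ->; exists y; split=> //; apply/H.
Qed.

(** * Normal forms *)

(** A logical predicate. The clause for C1 ∨ C2 demands that the arrow already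
    factors through one disjunct; the clause for a letter, that the arrow is a
    projection of A or comes from ⊥. At ⊤ and ⊥ nothing is demanded, as all
    arrows A ⊢ ⊤ are equal and so are all arrows A ⊢ ⊥. *)
Fixpoint resolved A C : A ⊢ C -> Prop :=
  match C return A ⊢ C -> Prop with
  | Letter p => fun a =>
      (exists x q, letter_proj x = Some (existT _ p q) /\ a ≡ q) \/
      (exists q : A ⊢ ⊥, a ≡ (kappao (Letter p) ∘ q))
  | Top | Bot => fun _ => True
  | And C1 C2 => fun a =>
      resolved (ka1 C1 C2 ∘ a)%A /\ resolved (ka2 C1 C2 ∘ a)%A
  | Or C1 C2 => fun a =>
      (exists2 b, resolved b & a ≡ (ko1 C1 C2 ∘ b)) \/
      (exists2 b, resolved b & a ≡ (ko2 C1 C2 ∘ b))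
  end.

Lemma resolved_aeq A C (a b : A ⊢ C) : a ≡ b -> resolved a -> resolved b.
Proof.
elim: C a b => [p|||C1 IH1 C2 IH2|C1 IH1 C2 IH2] //= a b E.
- case=> [[x [q [Hq Ha]]]|[q Ha]].
    by left; exists x, q; split; rewrite -?E.
  by right; exists q; rewrite -E.
- case=> H1 H2; split; first by apply: IH1 H1; rewrite E.
  by apply: IH2 H2; rewrite E.
- by case=> [[c Hc Ha]|[c Hc Ha]]; [left|right]; exists c => //; rewrite -E.
Qed.

(** An arrow that comes from ⊥ may make its disjunctive choices at will: both
    injections composed with the initial arrow give the initial arrow. *)
Lemma resolved_bot A C (q : A ⊢ ⊥) : resolved (kappao C ∘ q).
Proof.
elim: C => [p|||C1 IH1 C2 IH2|C1 IH1 C2 IH2] //=.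
- by right; exists q.
- split; [apply: resolved_aeq IH1 | apply: resolved_aeq IH2];
    by rewrite aeq_assoc -(aeq_initial (_ ∘ kappao _)).
- left; exists (kappao C1 ∘ q)%A => //.
  by rewrite aeq_assoc -(aeq_initial (_ ∘ kappao _)).
Qed.

(** Precomposition with a projection only lengthens the projections found at the
    letters. *)
Lemma resolved_ka1 A1 A2 C (a : A1 ⊢ C) :
  resolved a -> resolved (a ∘ ka1 A1 A2).
Proof.
elim: C a => [p|||C1 IH1 C2 IH2|C1 IH1 C2 IH2] //= a.
- case=> [[x [q [Hq Ha]]]|[q Ha]].
    by left; exists (inl x), (q ∘ ka1 A1 A2)%A; rewrite /= Hq Ha.
  by right; exists (q ∘ ka1 A1 A2)%A; rewrite Ha aeq_assoc.
- by case=> /IH1 H1 /IH2 H2; split;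
    [apply: resolved_aeq H1 | apply: resolved_aeq H2]; rewrite aeq_assoc.
- by case=> [[b Hb Ha]|[b Hb Ha]]; [left|right];
    exists (b ∘ ka1 A1 A2)%A; auto; rewrite Ha aeq_assoc.
Qed.

Lemma resolved_ka2 A1 A2 C (a : A2 ⊢ C) :
  resolved a -> resolved (a ∘ ka2 A1 A2).
Proof.
elim: C a => [p|||C1 IH1 C2 IH2|C1 IH1 C2 IH2] //= a.
- case=> [[x [q [Hq Ha]]]|[q Ha]].
    by left; exists (inr x), (q ∘ ka2 A1 A2)%A; rewrite /= Hq Ha.
  by right; exists (q ∘ ka2 A1 A2)%A; rewrite Ha aeq_assoc.
- by case=> /IH1 H1 /IH2 H2; split;
    [apply: resolved_aeq H1 | apply: resolved_aeq H2]; rewrite aeq_assoc.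
- by case=> [[b Hb Ha]|[b Hb Ha]]; [left|right];
    exists (b ∘ ka2 A1 A2)%A; auto; rewrite Ha aeq_assoc.
Qed.

(** This is where the absence of ∨ in A is used: an identity of a disjunction
    makes no choice between the disjuncts. *)
Lemma resolved_id A : or_free A -> resolved (idt A).
Proof.
elim: A => [p|||A1 IH1 A2 IH2|//] //=.
- by move=> _; left; exists tt, (idt (Letter p)).
- case/andP=> /IH1 H1 /IH2 H2; split.
    by apply: resolved_aeq (resolved_ka1 A2 H1); rewrite aeq_idl aeq_idr.
  by apply: resolved_aeq (resolved_ka2 A1 H2); rewrite aeq_idl aeq_idr.
Qed.

(** The clauses of [resolved] are exactly what is needed for induction on the
    term f alone: a diagonal or a projection acts on a component, ∨ on the chosen
    disjunct, and a composition is two successive steps. *)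
Lemma resolved_comp A C D (f : C ⊢ D) (a : A ⊢ C) :
  resolved a -> resolved (f ∘ a).
Proof.
move=> Ha; elim: f a Ha => {C D} /=.
- by move=> C a Ha; apply: resolved_aeq Ha; rewrite aeq_idl.
- by move=> C a Ha; split; apply: resolved_aeq Ha;
    rewrite aeq_assoc ?aeq_ka1_wa ?aeq_ka2_wa aeq_idl.
- by move=> C a [[b Hb Ha]|[b Hb Ha]]; apply: resolved_aeq Hb;
    rewrite Ha aeq_assoc ?aeq_wo_ko1 ?aeq_wo_ko2 aeq_idl.
- by move=> C1 C2 a [].
- by move=> C1 C2 a [].
- by move=> C1 C2 a Ha; left; exists a.
- by move=> C1 C2 a Ha; right; exists a.
- by [].
- by move=> C a _; apply: resolved_bot.
- move=> C D E g IHg f IHf a Ha.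
  by apply: resolved_aeq (IHg _ (IHf _ Ha)); rewrite aeq_assoc.
- move=> C1 C2 D1 D2 f1 IH1 f2 IH2 a [/IH1 H1 /IH2 H2]; split.
    by apply: resolved_aeq H1; rewrite !aeq_assoc aeq_ka1_nat.
  by apply: resolved_aeq H2; rewrite !aeq_assoc aeq_ka2_nat.
- move=> C1 C2 D1 D2 f1 IH1 f2 IH2 a [[b Hb Ha]|[b Hb Ha]]; [left|right].
    by exists (f1 ∘ b)%A; auto; rewrite Ha !aeq_assoc aeq_ko1_nat.
  by exists (f2 ∘ b)%A; auto; rewrite Ha !aeq_assoc aeq_ko2_nat.
Qed.

Definition through_letter A B (f : A ⊢ B) (x : leaf A) (y : leaf B) : Prop :=
  exists p q j, [/\ letter_proj x = Some (existT _ p q),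
                    letter_inj y = Some (existT _ p j)
                  & f ≡ (j ∘ q)].

(** When B has no ∧, unfolding [resolved] down to the letters and constants of B
    meets only choices between disjuncts, so it follows a single branch to one
    atom of B. *)
Lemma resolved_normal A B (f : A ⊢ B) : and_free B -> resolved f ->
  null f \/ exists x y, through_letter f x y.
Proof.
elim: B f => [p|||//|B1 IH1 B2 IH2] /= f.
- move=> _ [[x [q [Hq Hf]]]|Hf]; last by left; left.
  right; exists x, tt, p, q, (idt (Letter p)); split=> //.
  by rewrite aeq_idl.
- move=> _ _; left; right; exists (idt ⊤); rewrite -(aeq_terminal f).
  by rewrite -(aeq_terminal (_ ∘ _)).
- move=> _ _; left; left; exists f; rewrite (aeq_initial (idt ⊥)).
  by rewrite aeq_idl.
- case/andP=> /IH1 {}IH1 /IH2 {}IH2 [[b /IH1 Hb Hf]|[b /IH2 Hb Hf]].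
  + case: Hb => [[[q Hb]|[j Hb]]|[x [y [p [q [j [Hq Hj Hb]]]]]]].
    * left; left; exists q.
      by rewrite Hf Hb aeq_assoc -(aeq_initial (_ ∘ kappao _)).
    * left; right; exists (ko1 B1 B2 ∘ j)%A; by rewrite Hf Hb aeq_assoc.
    * right; exists x, (inl y), p, q, (ko1 B1 B2 ∘ j)%A.
      by split; rewrite //= ?Hj // Hf Hb aeq_assoc.
  + case: Hb => [[[q Hb]|[j Hb]]|[x [y [p [q [j [Hq Hj Hb]]]]]]].
    * left; left; exists q.
      by rewrite Hf Hb aeq_assoc -(aeq_initial (_ ∘ kappao _)).
    * left; right; exists (ko2 B1 B2 ∘ j)%A; by rewrite Hf Hb aeq_assoc.
    * right; exists x, (inr y), p, q, (ko2 B1 B2 ∘ j)%A.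
      by split; rewrite //= ?Hj // Hf Hb aeq_assoc.
Qed.

Lemma normal_form A B (f : A ⊢ B) : or_free A -> and_free B ->
  null f \/ exists x y, through_letter f x y.
Proof.
move=> hA hB; apply: resolved_normal => //.
by apply: resolved_aeq (resolved_comp f (resolved_id hA)); rewrite aeq_idr.
Qed.

(** * Coherence *)

Lemma rel_through A B (f : A ⊢ B) x y : through_letter f x y ->
  forall x' y', rel f x' y' <-> x' = x /\ y' = y.
Proof.
case=> p [q [j [Hq Hj /rel_aeq Hf]]] x' y'; rewrite Hf /=.
have Rq := rel_letter_proj Hq; have Rj := rel_letter_inj Hj.
split; first by case=> z [/Rq -> /Rj ->].
by case=> -> ->; exists tt; split; [apply/Rq | apply/Rj].
Qed.

End Lattice.

(** The pair (x, y) determines the letter, the projection and the injection. *)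
Lemma through_letter_uniq (P : eqType) (A B : formula P) (f g : A ⊢ B) x y :
  through_letter f x y -> through_letter g x y -> f ≡ g.
Proof.
case=> p [q [j [Hq Hj ->]]] [p' [q' [j' [Hq' Hj' ->]]]].
(* The letters read off from the two normal forms agree only propositionally;
   decidable equality of letters identifies the arrows over them. *)
have p_dec (a b : P) : {a = b} + {a <> b} by exact: eq_comparable.
rewrite Hq in Hq'; rewrite Hj in Hj'; case: Hq' => E; subst p'.
move/(@inj_pair2_eq_dec _ p_dec (fun p => A ⊢ Letter p)) => <-.
case: Hj' => /(@inj_pair2_eq_dec _ p_dec (fun p => Letter p ⊢ B)) <-.
by [].
Qed.

Lemma coherence_free (P : eqType) (A B : formula P) (f g : A ⊢ B) :
  or_free A -> and_free B -> G f = G g -> f ≡ g.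
Proof.
move=> hA hB /G_rel E.
case: (normal_form f hA hB) (normal_form g hA hB) =>
  [Nf|[x [y Tf]]] [Ng|[x' [y' Tg]]].
- exact: null_uniq.
- by case: (rel_null (x:=x') (y:=y') Nf); apply/E/(rel_through Tg).
- by case: (rel_null (x:=x) (y:=y) Ng); apply/E/(rel_through Tf).
- have /E/(rel_through Tg)[Ex Ey] : rel f x y by apply/(rel_through Tf).
  by subst x' y'; apply: through_letter_uniq Tf Tg.
Qed.

Theorem mainTheorem8 (P : eqType)
    (P_infinite : forall s : seq P, exists p : P, p \notin s)
    (A B : formula P) (f g : A ⊢ B) (hA : dnf A) (hB : cnf B) :
  G f = G g -> f ≡ g.
Proof.
elim: hA f g => {A} [A hA|A1 A2 _ IH1 _ IH2] f g E; last first.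
  by apply: copair_ext; [apply: IH1 | apply: IH2]; rewrite /= E.
elim: hB f g E => {B} [B hB|B1 B2 _ IH1 _ IH2] f g E.
  exact: coherence_free.
by apply: pair_ext; [apply: IH1 | apply: IH2]; rewrite /= E.
Qed.
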